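(* In the restricted multi-armed bandit (RMAB) model described in the context, for any restricted policy $T$ and any index policy $\hat T$, one has $\underline v(T)\le\underline v(\hat T)$, where $$\underline v(T)=E\left[\sum_{k=1}^d\int_0^\infty\beta e^{-\beta t}\,\underline M^k(T^k(t))\,dT^k(t)\right].$$
   Context: RMAB model. Let $\beta>0$ and $d\ge 1$. On a probability space $(\Omega,\mathcal F,P)$ there are $d$ arms $(X^k,\mathcal F^k,\mathcal M^k)$, $k=1,\dots,d$. (i) $\mathcal F^k=\{\mathcal F^k_t\}_{t\ge0}$ is a quasi-left-continuous filtration satisfying the usual conditions, with $\mathcal F^k_0$ trivial mod $P$; the filtrations $\mathcal F^1,\dots,\mathcal F^d$ are mutually independent. (ii) $X^k=(X^k_t)_{t\ge0}$ is nonnegative, $\mathcal F^k$-progressive, and $E\int_0^\infty e^{-\beta t}X^k_t\,dt<\infty$. (iii) The feasible time set $\mathcal M^k\subset[0,\infty]\times\Omega$ is an $\mathcal F^k$-adapted random set such that each section $\mathcal M^k(\omega)=\{t:(t,\omega)\in\mathcal M^k\}$ is closed and contains $0$ and $\infty$. For an $\mathcal F^k$-stopping time $\tau$, write $\tau\in\mathcal M^k$ if $\tau(\omega)\in\mathcal M^k(\omega)$ a.s. Restricted policies. A (restricted) policy is a process $T(t)=(T^1(t),\dots,T^d(t))$, $t\ge 0$, such that: (1) $T$ is componentwise nondecreasing with $T(0)=0$; (2) $\sum_k T^k(t)=t$ for all $t\ge0$; (3) for every $s\in\mathbb R_+^d$, $\{T(t)\le s\}\in\mathcal F^1_{s_1}\vee\dots\vee\mathcal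 F^d_{s_d}$; (4) the right derivative satisfies $\frac{d^+T^k(t)}{dt}=1$ whenever $(T^k(t),\omega)\notin\mathcal M^k$. Gittins indices. For a finite $\mathcal F^k$-stopping time $\eta\in\mathcal M^k$, $$M^k_\eta=\operatorname{esssup}_{\tau>\eta,\ \tau\in\mathcal M^k}\frac{E[\int_\eta^\tau e^{-\beta u}X^k_u\,du\mid\mathcal F^k_\eta]}{\beta E[\int_\eta^\tau e^{-\beta u}\,du\mid\mathcal F^k_\eta]},$$ the supremum being over $\mathcal F^k$-stopping times $\tau$. The Gittins index process $(M^k_t)_{0\le t<\infty}$ is the process associated with (aggregating) this family on $\mathcal M^k$, and for $t\notin\mathcal M^k(\omega)$ one puts $M^k_t(\omega)=M^k_{\underline t}(\omega)$ with $\underline t=\sup\{s\le t: s\in\mathcal M^k(\omega)\}$. Its lower envelope is $\underline M^k(t)=\min_{0\le u\le t}M^k_u$. (Equivalently, $\underline M^k(t)=\sup\{m\ge0:\sigma^k_0(m)>t\}$, where $V^k(\eta,m)=\operatorname{esssup}_{\tau\ge\eta,\tau\in\mathcal M^k}E[\int_\eta^\tau e^{-\beta(u-\eta)}X^k_u du+me^{-\beta(\tau-\eta)}\mid\mathcal F^k_\eta]$ and $\sigma^k_0(m)=\operatorname{essinf}\{\tau\in\mathcal M^k:V^k(\tau,m)=m\}$, in a version nonincreasing and right-continuous in $m$.) Index policies. Let $\mathcal M^k_1(\omega)=\mathrm{closure}\{t:t\in\mathcal M^k(\omega),\ M^k_t(\omega)=\underline M^k(t,\omega)\}$. The times in the complement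 of $\mathcal M_1^k(\omega)$ are the excursion times of $M^k$; they form a countable union of open intervals, the excursion intervals. A restricted policy $\hat T$ is an index policy if for each $k$, $\hat T^k$ right increases at $t\ge0$ (i.e. $\hat T^k(t+h)>\hat T^k(t)$ for all $h>0$) only when $M^k_{\hat T^k(t)}=\bigvee_{j=1}^dM^j_{\hat T^j(t)}$, and time is allocated exclusively to a single arm over each of its excursion intervals, without switching. *)

(* Defs.v *)
From HB Require Import structures.
From mathcomp Require Import all_boot all_order all_algebra.
From mathcomp Require Import all_classical all_reals all_analysis.
From mathcomp Require Import measurable_realfun.
From mathcomp Require Import lra.

Set Implicit Arguments.
Unset Strict Implicit.
Unset Printing Implicit Defensive.

Import Order.TTheory GRing.Theory Num.Theory.
Import numFieldNormedType.Exports.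

Local Open Scope classical_set_scope.
Local Open Scope ring_scope.

(* A filtration is a family of sets of events indexed by R; only the indices
   t >= 0 are ever used. Random times take values in [0, +oo], as elements of
   \bar R. *)

Section filtrations.
Context {R : realType} {dO : measure_display} {Omega : measurableType dO}.
Variable P : probability Omega R.
Implicit Types (F : R -> set (set Omega)) (tau : Omega -> \bar R).

Definition filtration F :=
  [/\ forall t, 0 <= t -> sigma_algebra [set: Omega] (F t),
      forall t, 0 <= t -> F t `<=` measurable &
      forall s t, 0 <= s -> s <= t -> F s `<=` F t].

Definition usual_conditions F :=
  (forall t, 0 <= t -> \bigcap_(s in [set s | t < s]) F s `<=` F t) /\
  (forall N : set Omega, P.-negligible N -> F 0 N).

Definition filtration_infty F : set (set Omega) :=
  <<s \bigcup_(t in [set t : R | 0 <= t]) F t >>.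

Definition stopping_time F tau :=
  (forall w, (0 <= tau w)%E) /\
  (forall t, 0 <= t -> F t [set w | (tau w <= t%:E)%E]).

(* F_tau and F_(tau-). *)
Definition stopped_sigma F tau : set (set Omega) :=
  [set A | filtration_infty F A /\
    forall t, 0 <= t -> F t (A `&` [set w | (tau w <= t%:E)%E])].

Definition strict_past F tau : set (set Omega) :=
  <<s F 0 `|` [set B | exists t A, [/\ 0 <= t, F t A &
                 B = A `&` [set w | (t%:E < tau w)%E]]] >>.

Definition predictable_time F tau :=
  stopping_time F tau /\
  exists tau_ : nat -> Omega -> \bar R,
    (forall n, stopping_time F (tau_ n)) /\
    {ae P, forall w,
      [/\ {homo tau_ ^~ w : m n / (m <= n)%N >-> (m <= n)%E},
          tau_ ^~ w @ \oo --> tau w &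
          (0 < tau w)%E -> forall n, (tau_ n w < tau w)%E]}.

Definition quasi_left_continuous F :=
  forall tau, predictable_time F tau -> stopped_sigma F tau = strict_past F tau.

Definition trivial_mod (G : set (set Omega)) :=
  forall A, G A -> P A = 0%E \/ P A = 1%E.

Definition independent_filtrations n (F : 'I_n -> R -> set (set Omega)) :=
  forall (J : {set 'I_n}) (A : 'I_n -> set Omega),
    (forall k, k \in J -> filtration_infty (F k) (A k)) ->
    P (\bigcap_(k in [set` J]) A k) = (\prod_(k in J) P (A k))%E.

Definition progressive F (X : R -> Omega -> R) :=
  forall t, 0 <= t ->
    measurable_fun
      (`[0, t] `*` setT : set (measurableTypeR R * g_sigma_algebraType (F t)))
      (fun p => X p.1 p.2).

(* g is a version of E[f | G], for f with values in [0, +oo]. *)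
Definition cond_expectation (G : set (set Omega)) (f g : Omega -> \bar R) :=
  [/\ measurable_fun setT (g : g_sigma_algebraType G -> \bar R),
      forall w, (0 <= g w)%E &
      forall A, G A -> (\int[P]_(w in A) g w = \int[P]_(w in A) f w)%E].

(* Z is the essential supremum of the family Phi of random variables; this is
   not the library's ess_sup, which is a number attached to one function. *)
Definition is_esssup (Phi : set (Omega -> \bar R)) (Z : Omega -> \bar R) :=
  [/\ measurable_fun setT Z,
      forall f, Phi f -> {ae P, forall w, (f w <= Z w)%E} &
      forall Z', measurable_fun setT Z' ->
        (forall f, Phi f -> {ae P, forall w, (f w <= Z' w)%E}) ->
        {ae P, forall w, (Z w <= Z' w)%E}].

End filtrations.

Record arm (R : realType) (dO : measure_display) (Omega : measurableType dO) :=
  Arm {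
    reward : R -> Omega -> R ;
    info : R -> set (set Omega) ;
    feasible : Omega -> set (\bar R)
  }.

Section model.
Context {R : realType} {dO : measure_display} {Omega : measurableType dO}.
Variables (P : probability Omega R) (beta : R).

(* feasible_adapted only asks that the indicator process of the random set be
   adapted, which is implied by progressive or optional measurability. *)
Record rmab_arm (a : arm R Omega) : Prop := RmabArm {
  info_filtration : filtration (info a) ;
  info_usual : usual_conditions P (info a) ;
  info_qlc : quasi_left_continuous P (info a) ;
  info_trivial : trivial_mod P (info a 0) ;
  reward_ge0 : forall t w, 0 <= t -> 0 <= reward a t w ;
  reward_progressive : progressive (info a) (reward a) ;
  reward_integrable :
    (\int[P]_w \int[lebesgue_measure]_(t in `[0%R, +oo[)
       (expR (- (beta * t)) * reward a t w)%:E < +oo)%E ;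
  feasible_adapted :
    forall t, 0 <= t -> info a t [set w | feasible a w t%:E] ;
  feasible_range : forall w, feasible a w `<=` [set x | (0 <= x)%E] ;
  feasible_closed : forall w, closed (feasible a w) ;
  feasible0 : forall w, feasible a w 0%E ;
  feasibley : forall w, feasible a w +oo%E
}.

Definition rmab n (a : 'I_n -> arm R Omega) :=
  (forall k, rmab_arm (a k)) /\
  independent_filtrations P (fun k => info (a k)).

Definition feasible_time (a : arm R Omega) (tau : Omega -> \bar R) :=
  stopping_time (info a) tau /\ {ae P, forall w, feasible a w (tau w)}.

Definition discounted (Y : R -> Omega -> R) (eta tau : Omega -> \bar R)
    (w : Omega) : \bar R :=
  (\int[lebesgue_measure]_(u in [set u : R | (eta w <= u%:E <= tau w)%E])
     (expR (- (beta * u)) * Y u w)%:E)%E.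

Definition index_ratios (a : arm R Omega) (eta : Omega -> \bar R) :
    set (Omega -> \bar R) :=
  [set f | exists tau N D,
    [/\ feasible_time a tau,
        {ae P, forall w, (eta w < tau w)%E},
        cond_expectation P (stopped_sigma (info a) eta)
          (discounted (reward a) eta tau) N,
        cond_expectation P (stopped_sigma (info a) eta)
          (discounted (fun _ _ => 1) eta tau) D &
        f = (fun w => N w / (beta%:E * D w))%E]].

(* The last feasible time up to t. *)
Definition last_feasible (a : arm R Omega) (t : R) (w : Omega) : R :=
  sup [set s | 0 <= s <= t /\ feasible a w s%:E].

(* M aggregates the family of indices. The index may be infinite, so M takes
   values in [0, +oo]. No regularity in t or joint measurability is asked of
   the aggregating process. *)
Record gittins_index_process (a : arm R Omega) (M : R -> Omega -> \bar R) :
    Prop := GittinsIndexProcess {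
  gittins_ge0 : forall t w, 0 <= t -> (0 <= M t w)%E ;
  gittins_aggregates : forall eta : Omega -> \bar R,
    feasible_time a eta -> (forall w, (eta w < +oo)%E) ->
    is_esssup P (index_ratios a eta) (fun w => M (fine (eta w)) w) ;
  gittins_infeasible : forall t w, 0 <= t -> ~ feasible a w t%:E ->
    M t w = M (last_feasible a t w) w
}.

Definition lower_envelope (M : R -> Omega -> \bar R) (t : R) (w : Omega) :
    \bar R :=
  ereal_inf [set M u w | u in `[0, t]].

(* The trace on [0, +oo[ of the closure of the set of feasible times at which
   M meets its lower envelope. *)
Definition ladder_times (a : arm R Omega) (M : R -> Omega -> \bar R)
    (w : Omega) : set R :=
  closure [set t | [/\ 0 <= t, feasible a w t%:E &
                       M t w = lower_envelope M t w]].

(* ]x, y[ is a connected component of the complement of the ladder times. *)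
Definition excursion_interval (a : arm R Omega) (M : R -> Omega -> \bar R)
    (w : Omega) (x : R) (y : \bar R) :=
  [/\ (x%:E < y)%E, ladder_times a M w x,
      forall s, ladder_times a M w s -> s <= x \/ (y <= s%:E)%E &
      y = +oo%E \/ exists2 s, y = s%:E & ladder_times a M w s].

End model.

Record policy (R : realType) (dO : measure_display) (Omega : measurableType dO)
    (n : nat) (a : 'I_n -> arm R Omega) := Policy {
  clock :> 'I_n -> R -> Omega -> R ;
  clock_nd : forall k w s t, 0 <= s -> s <= t -> clock k s w <= clock k t w ;
  clock0 : forall k w, clock k 0 w = 0 ;
  clock_sum : forall w t, 0 <= t -> \sum_(k < n) clock k t w = t ;
  clock_adapted : forall (t : R) (s : 'I_n -> R),
    0 <= t -> (forall k, 0 <= s k) ->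
    <<s \bigcup_(k in [set: 'I_n]) info (a k) (s k) >>
      [set w | forall k, clock k t w <= s k] ;
  clock_feasible : forall k w t, 0 <= t ->
    ~ feasible (a k) w (clock k t w)%:E ->
    h^-1 * (clock k (t + h) w - clock k t w) @[h --> 0^'+] --> (1 : R)
}.

Section stieltjes.
Context {R : realType} {dO : measure_display} {Omega : measurableType dO}.
Context {n : nat} {a : 'I_n -> arm R Omega}.
Implicit Types (T : policy a) (k : 'I_n) (w : Omega).

(* The path of the k-th clock, extended by 0 to negative times. It is
   1-Lipschitz because the clocks add up to t, so that dT^k has no atom. *)
Definition clock_path T k w (t : R) : R := T k (Num.max 0 t) w.

Lemma clock_path_nd T k w : nondecreasing (clock_path T k w).
Proof.
move=> s t st; apply: clock_nd; first by rewrite le_max lexx.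
by rewrite ge_max !le_max lexx st orbT.
Qed.

Lemma clock_lip T k w s t : 0 <= s -> s <= t -> T k t w - T k s w <= t - s.
Proof.
move=> s0 st; have t0 := le_trans s0 st.
rewrite -[in leRHS](clock_sum T w t0) -[in leRHS](clock_sum T w s0) -sumrB.
rewrite (bigD1 k)//= lerDl sumr_ge0// => j _.
by rewrite subr_ge0; exact: clock_nd.
Qed.

Lemma clock_path_rc T k w : right_continuous (clock_path T k w).
Proof.
move=> x; apply/cvgrPdist_lt => e e0; near=> t.
have xt : x < t by near: t; exact: nbhs_right_gt.
have tx : t < x + e by near: t; apply: nbhs_right_lt; rewrite ltrDl.
rewrite distrC ger0_norm ?subr_ge0; last exact/clock_path_nd/ltW.
have m0 : 0 <= Num.max 0 x :> R by rewrite le_max lexx.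
have mt : Num.max 0 x <= Num.max 0 t by rewrite ge_max !le_max lexx (ltW xt) orbT.
apply: le_lt_trans (clock_lip T k w m0 mt) _.
by rewrite !maxEle; case: ifPn => ?; case: ifPn => ?; lra.
Unshelve. all: by end_near. Qed.

HB.instance Definition _ T k w :=
  isCumulative.Build R _ R (clock_path T k w)
    (@clock_path_nd T k w) (@clock_path_rc T k w).

End stieltjes.

Section index.
Context {R : realType} {dO : measure_display} {Omega : measurableType dO}.
Variables (P : probability Omega R) (beta : R).
Context {n : nat} {a : 'I_n -> arm R Omega}.
Variable M : 'I_n -> R -> Omega -> \bar R.

(* The index processes being determined up to null sets, the conditions are
   imposed almost surely. *)
Definition index_policy (T : policy a) :=
  {ae P, forall w,
    (forall k t, 0 <= t -> (forall h, 0 < h -> T k t w < T k (t + h) w) ->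
       M k (T k t w) w = \big[maxe/-oo%E]_(j < n) M j (T j t w) w) /\
    (forall k x y, excursion_interval (a k) (M k) w x y ->
       forall s t, 0 <= s -> s <= t ->
         x < T k s w -> ((T k t w)%:E < y)%E ->
         T k t w - T k s w = t - s)}.

Definition lower_value (T : policy a) : \bar R :=
  (\int[P]_w \sum_(k < n)
     \int[lebesgue_stieltjes_measure (clock_path T k w)]_(t in `[0%R, +oo[)
       ((beta * expR (- (beta * t)))%:E
          * lower_envelope (M k) (T k t w) w))%E.

End index.

(* Main.v *)
Require Import Defs.
From mathcomp Require Import all_boot all_order all_algebra.
From mathcomp Require Import all_classical all_reals all_analysis.
From mathcomp Require Import measurable_realfun.
From mathcomp Require Import lra.

Set Implicit Arguments.
Unset Strict Implicit.
Unset Printing Implicit Defensive.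

Import Order.TTheory GRing.Theory Num.Theory.
Import numFieldNormedType.Exports.

Local Open Scope classical_set_scope.
Local Open Scope ring_scope.

(** The inequality holds path by path. Fix an outcome and let m_k be the lower
    envelope of the k-th index process, a nonincreasing function. Writing
    beta exp(- beta t) as the integral over r >= t of beta^2 exp(- beta r) and
    exchanging the integrals ([discounted_integral]), then substituting
    s = T^k(t) ([integral_stieltjes_comp]), turns the value of a policy T into
    the integral over r >= 0 of beta^2 exp(- beta r) V_T(r), where V_T(r) is the
    sum over k of the integral of m_k over [0, T^k(r)]. It is therefore enough
    to compare V_T(r) with V_That(r) at each r.

    At a fixed r this is a problem of dividing r units of time between
    nonincreasing reward rates, solved by any greedy division: one in which
    every rate collected on some arm is at least every rate left uncollected
    on any arm ([greedy_sum_le]).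

    An index policy is greedy ([index_policy_greedy]). Any level u < That^k(r)
    of the k-th clock is left for the last time at some x <= r; the clock right
    increases there, so M^k_u is the largest current index. It is at least the
    index of arm j at That^j(x), hence at least m_j(That^j(r)) because
    That^j(x) <= That^j(r). Taking the infimum over all u <= s gives
    m_k(s) >= m_j(That^j(r)) for s < That^k(r).

    The pathwise values need not be measurable in the outcome; the integral of
    a nonnegative function is a supremum over the simple functions below it, and
    as such it is monotone almost everywhere without measurability
    ([ae_le_integral_nonmeasurable]). *)

(** * Change of variable in a Stieltjes integral *)

Section stieltjes_change_of_variable.
Context {R : realType}.

Lemma nondecreasing_emeasurable (D : set R) (f : R -> \bar R) :
  measurable D -> {homo f : s t / s <= t >-> (s <= t)%E} -> measurable_fun D f.
Proof.
move=> mD f_nd.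
apply: (measurability _ (ErealGenCInfty.measurableE R)) => // _ [_ [r ->] <-].
apply: measurableI => //; apply: is_interval_measurable => s t/=.
rewrite !in_itv/= !andbT => fs ft u /andP[su ut].
by rewrite in_itv/= andbT (le_trans fs)// f_nd.
Qed.

Lemma nonincreasing_emeasurable (D : set R) (f : R -> \bar R) :
  measurable D -> {homo f : s t / s <= t >-> (t <= s)%E} -> measurable_fun D f.
Proof.
move=> mD f_ni; rewrite (_ : f = (fun x => - (- f x))%E); last first.
  by apply/funext => x; rewrite oppeK.
apply: measurableT_comp => //; apply: nondecreasing_emeasurable => // s t st.
by rewrite leeN2 f_ni.
Qed.

(** The passage through [c] is taken to be the last one, so that the level set
    [F > c] is exactly the open ray to the right of [x], even when [F] is
    constant on intervals. *)
Lemma last_passage (F : R -> R) (a b c : R) :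
  {homo F : s t / s <= t} -> continuous F -> F a <= c -> c < F b ->
  exists2 x, a <= x < b & F x = c /\ forall t, x < t -> c < F t.
Proof.
move=> ndF cF Fac cFb.
have ab : a < b by rewrite ltNge; apply/negP => /ndF ba; lra.
pose S := [set t | F t <= c].
have Sa : S a by [].
have ubS : has_ubound S.
  exists b => t St; rewrite leNgt; apply/negP => /ltW/ndF.
  by rewrite /S/= in St; lra.
have cS : closed S.
  apply: (@preimage_closed _ _ F [set x | x <= c]); last exact: closed_le.
  by move=> x _; exact: cF.
have Ss : F (sup S) <= c by apply: cS; apply: closure_sup => //; exists a.
have [y _ Fy] : exists2 y, y \in `[a, b] & F y = c.
  apply: IVT; first exact: ltW.
    exact: continuous_subspaceT.
  by rewrite ge_min Fac/= le_max (ltW cFb) orbT.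
have ys : y <= sup S by apply: ub_le_sup => //; rewrite /S/= Fy.
have as_ : a <= sup S by apply: ub_le_sup.
exists (sup S).
  rewrite as_/= ltNge; apply/negP => /ndF; lra.
split; first by apply/eqP; rewrite eq_le Ss -Fy ndF.
move=> t st; rewrite ltNge; apply/negP => Ft.
by have := ub_le_sup ubS Ft; rewrite leNgt st.
Qed.

Lemma stieltjes_itvoc (F : cumulative R R) (a b : R) : a <= b ->
  lebesgue_stieltjes_measure F `]a, b]%classic = (F b - F a)%:E.
Proof.
move=> ab; rewrite /lebesgue_stieltjes_measure /measure_extension/=.
by rewrite measurable_mu_extE/= ?wlength_itv_bnd//; exact: is_ocitv.
Qed.

(** [F] transports its own Stieltjes measure on [`]a, b]] to the Lebesgue
    measure on [`]F a, F b]]. The two finite measures are compared on the rays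
    [`]x, +oo[], whose preimages are described by the last passage of [F]
    through [x]. *)
Lemma pushforward_stieltjes (F : cumulative R R) (a b : R)
    (mab : measurable (`]a, b]%classic : set (measurableTypeR R)))
    (mFab : measurable (`]F a, F b]%classic : set (measurableTypeR R))) :
  a <= b -> continuous F ->
  forall A, measurable A ->
  pushforward (mrestr (lebesgue_stieltjes_measure F) mab)
    (F : measurableTypeR R -> measurableTypeR R) A =
  mrestr (@lebesgue_measure R) mFab A.
Proof.
move=> ab cF.
have ndF : {homo F : s t / s <= t} := cumulative_is_nondecreasing F.
have mF : measurable_fun setT (F : measurableTypeR R -> measurableTypeR R).
  exact: continuous_measurable_fun.
have [nu nuFE] : exists nu : {measure set (measurableTypeR R) -> \bar R},
    nu = pushforward (mrestr (lebesgue_stieltjes_measure F) mab)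
      (F : measurableTypeR R -> measurableTypeR R) :> (set _ -> _).
  (* The measure structure of a pushforward takes the measurability of F as an
     argument. *)
  unshelve refine (ex_intro _ [the measure (measurableTypeR R) R of
    pushforward (mrestr (lebesgue_stieltjes_measure F) mab)
      (F : measurableTypeR R -> measurableTypeR R)] _) => //.
pose la : {measure set (measurableTypeR R) -> \bar R} :=
  [the measure _ _ of mrestr (@lebesgue_measure R) mFab].
have nuE x : nu `]x, +oo[%classic = la `]x, +oo[%classic.
  rewrite nuFE /la /= /pushforward /mrestr.
  have [Fbx|xFb] := leP (F b) x.
    rewrite (_ : _ `&` _ = set0); last first.
      apply/seteqP; split => // t /=; rewrite !in_itv/= andbT => -[xt /andP[_ /ndF]].
      lra.
    rewrite (_ : _ `&` _ = set0) ?measure0//.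
    apply/seteqP; split => // t /=; rewrite !in_itv/=; lra.
  have [xFa|Fax] := ltP x (F a).
    rewrite (_ : _ `&` _ = `]a, b]%classic); last first.
      apply/seteqP; split => t /=; rewrite !in_itv/= andbT; first by case.
      move=> /andP[at_ tb]; split; last by rewrite at_.
      by rewrite (lt_le_trans xFa)// ndF// ltW.
    rewrite (_ : _ `&` _ = `]F a, F b]%classic); last first.
      by apply/seteqP; split => t /=; rewrite !in_itv/= andbT; [case|lra].
    by rewrite stieltjes_itvoc// /lebesgue_measure stieltjes_itvoc// ndF.
  have [y /andP[ay yb] [Fy yF]] := last_passage ndF cF Fax xFb.
  rewrite (_ : _ `&` _ = `]y, b]%classic); last first.
    apply/seteqP; split => t /=; rewrite !in_itv/= andbT.
      move=> [xt /andP[_ ->]]; rewrite andbT ltNge; apply/negP => /ndF; lra.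
    by move=> /andP[yt tb]; split; [exact: yF|lra].
  rewrite (_ : _ `&` _ = `]x, F b]%classic); last first.
    by apply/seteqP; split => t /=; rewrite !in_itv/= andbT; lra.
  rewrite stieltjes_itvoc ?(ltW yb)//.
  by rewrite /lebesgue_measure stieltjes_itvoc ?(ltW xFb)// Fy.
move=> A mA; rewrite -nuFE -[RHS]/(la A).
apply: (@measure_unique _ _ (measurableTypeR R) (@RGenOInfty.G R)
  (fun n => `](- n%:R)%R, +oo[%classic)) mA.
- exact: RGenOInfty.measurableE.
- move=> _ _ [x ->] [y ->]; exists (Num.max x y); apply/seteqP; split => t /=.
    by rewrite !in_itv/= !andbT gt_max => -[-> ->].
  by rewrite !in_itv/= !andbT gt_max => /andP.
- by move=> n; exists (- n%:R).
- apply/seteqP; split => // t _; exists (Num.truncn `|t|).+1 => //=.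
  rewrite in_itv/= andbT ltrNl; apply: le_lt_trans (Num.Theory.truncnS_gt _).
  by rewrite -normrN ler_norm.
- by move=> _ [x ->].
- move=> n; rewrite nuFE /pushforward /mrestr.
  apply: (@le_lt_trans _ _ (lebesgue_stieltjes_measure F `]a, b]%classic)).
    apply: le_measure; rewrite ?inE//.
    by apply: measurableI => //; rewrite -[X in measurable X]setTI; exact: mF.
  by rewrite stieltjes_itvoc// ltry.
Qed.

Lemma integral_stieltjes_comp (F : cumulative R R) (a b : R) (g : R -> \bar R) :
  a <= b -> continuous F -> measurable_fun setT g -> (forall x, 0 <= g x)%E ->
  (\int[lebesgue_stieltjes_measure F]_(t in `]a, b]) g (F t) =
   \int[lebesgue_measure]_(s in `]F a, F b]) g s)%E.
Proof.
move=> ab cF mg g0.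
have mF : measurable_fun setT (F : measurableTypeR R -> measurableTypeR R).
  exact: continuous_measurable_fun.
have mab : measurable (`]a, b]%classic : set (measurableTypeR R)).
  exact: measurable_itv.
have mFab : measurable (`]F a, F b]%classic : set (measurableTypeR R)).
  exact: measurable_itv.
(* Restricting the measures moves both domains of integration to the whole
   line, where the transport formula applies. *)
have restrE (mu : {measure set (measurableTypeR R) -> \bar R})
    (D : set (measurableTypeR R)) (mD : measurable D) (f : measurableTypeR R -> \bar R) :
    measurable_fun setT f -> (forall x, 0 <= f x)%E ->
    (\int[mu]_(x in D) f x = \int[mrestr mu mD]_x f x)%E.
  move=> mf f0; rewrite [RHS](@ge0_negligible_integral _ _ _ _ _ (~` D))//;
    last 2 first.
  - exact: measurableC.
  - by rewrite /= /mrestr setICl measure0.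
  rewrite setTD setCK; apply: eq_measure_integral => A mA AD.
  by rewrite /= /mrestr setIidl.
have mgF : measurable_fun setT (g \o F : measurableTypeR R -> \bar R).
  exact: measurableT_comp.
have gF0 x : (0 <= (g \o F) x)%E by exact: g0.
transitivity (\int[mrestr (lebesgue_stieltjes_measure F) mab]_t (g \o F) t)%E.
  exact: (restrE (lebesgue_stieltjes_measure F) _ mab _ mgF gF0).
transitivity (\int[mrestr (@lebesgue_measure R) mFab]_s g s)%E; last first.
  exact/esym/(restrE (@lebesgue_measure R) _ mFab _ mg g0).
rewrite -[LHS]/(integral (mrestr (lebesgue_stieltjes_measure F) mab)
  ((F : measurableTypeR R -> measurableTypeR R) @^-1` setT) (g \o F)).
rewrite -(@ge0_integral_pushforward _ _ _ _ R
  (F : measurableTypeR R -> measurableTypeR R) mF).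
- apply: eq_measure_integral => // A mA _.
  exact: pushforward_stieltjes.
- exact: measurableT.
- exact: mg.
- by move=> y _; exact: g0.
Qed.

(** The closed end point 0 carries no mass, since [F] is constant on the
    negative half line. *)
Lemma integral_stieltjes_comp0 (F : cumulative R R) (r : R) (g : R -> \bar R) :
  0 <= r -> continuous F -> (forall t, t <= 0 -> F t = 0) ->
  measurable_fun setT g -> (forall x, 0 <= g x)%E ->
  (\int[lebesgue_stieltjes_measure F]_(t in `[0%R, r]) g (F t) =
   \int[lebesgue_measure]_(s in `]0%R, F r]) g s)%E.
Proof.
move=> r0 cF F0 mg g0.
have mF : measurable_fun setT (F : measurableTypeR R -> measurableTypeR R).
  exact: continuous_measurable_fun.
have mgF : measurable_fun setT (g \o F : measurableTypeR R -> \bar R).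
  exact: measurableT_comp.
have FN1 : F (-1) = 0 by apply: F0; rewrite lerN10.
rewrite -[in RHS]FN1 -integral_stieltjes_comp//; last by lra.
have mN : measurable (`]-1, 0[%classic : set (measurableTypeR R)).
  exact: measurable_itv.
have N0 : lebesgue_stieltjes_measure F `]-1, 0[%classic = 0%E.
  apply/eqP; rewrite eq_le measure_ge0 andbT.
  have -> : 0%E = lebesgue_stieltjes_measure F `]-1, 0]%classic.
    by rewrite stieltjes_itvoc ?lerN10// FN1 F0// subrr.
  apply: le_measure.
  - by rewrite inE.
  - by rewrite inE; exact: measurable_itv.
  - by apply: subset_itvl; rewrite bnd_simp.
have -> : `[0, r]%classic = `]-1, r]%classic `\` `]-1, 0[%classic.
  apply/seteqP; split => t /=; rewrite !in_itv/=.
    by move=> /andP[t0 tr]; split; [|apply/negP]; lra.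
  by move=> [/andP[t1 ->]] /negP; rewrite t1/= -leNgt => ->.
apply/esym; apply: (@ge0_negligible_integral _ _ _ (lebesgue_stieltjes_measure F)).
- exact: mN.
- exact: measurable_itv.
- by apply: measurable_funS mgF.
- by move=> x _; exact: g0.
- exact: N0.
Qed.

End stieltjes_change_of_variable.

(** * Discounting as a mixture of deterministic horizons *)

Section discounting.
Context {R : realType}.

Lemma integral_expR_tail (beta t : R) : 0 < beta ->
  (\int[lebesgue_measure]_(r in `[t, +oo[) (beta ^+ 2 * expR (- (beta * r)))%:E
   = (beta * expR (- (beta * t)))%:E)%E.
Proof.
move=> b0.
rewrite (@ge0_continuous_FTC2y _ _ (fun r => - (beta * expR (- (beta * r)))) _ 0).
- by rewrite sub0e -EFinN opprK.
- by move=> r _; rewrite mulr_ge0 ?expR_ge0// sqr_ge0.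
- apply: continuous_subspaceT => x.
  apply: cvgMr; apply: continuous_comp; last exact: continuous_expR.
  by apply: cvgN; apply: cvgMr.
- rewrite -oppr0 -(mulr0 beta); apply: cvgN; apply: cvgMr.
  apply: (@cvg_comp _ _ _ (fun x => beta * x) (fun x => expR (- x)) _
    (pinfty_nbhs R)); last exact: cvgr_expR.
  exact: gt0_cvgMry.
- by move=> x _; exact: ex_derive.
- apply: cvg_at_right_filter; apply: cvgN; apply: cvgMr.
  apply: continuous_comp; last exact: continuous_expR.
  by apply: cvgN; apply: cvgMr.
- move=> x _; rewrite derive1E; apply: derive_val.
  apply: is_derive_eq.
  by rewrite /GRing.scale/= mulr1 expr2; lra.
Qed.

(** A discounted integral is an average of undiscounted integrals over [0, r],
    the horizon [r] having weight [beta ^+ 2 * expR (- (beta * r))]. *)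
Lemma discounted_integral
    (mu : {sigma_finite_measure set (measurableTypeR R) -> \bar R})
    (beta : R) (h : R -> \bar R) :
  0 < beta -> measurable_fun setT h -> (forall t, 0 <= h t)%E ->
  (\int[mu]_(t in `[0%R, +oo[) ((beta * expR (- (beta * t)))%:E * h t) =
   \int[lebesgue_measure]_r ((beta ^+ 2 * expR (- (beta * r)))%:E *
      \int[mu]_(t in `[0%R, r]) h t))%E.
Proof.
move=> b0 mh h0.
pose e r := beta ^+ 2 * expR (- (beta * r)).
have me : measurable_fun setT (EFin \o e).
  apply/measurable_EFinP; apply: measurable_funM => //.
  apply: measurableT_comp => //; apply: measurable_funN.
  exact: measurable_funM.
have e0 r : 0 <= e r by rewrite mulr_ge0 ?expR_ge0// sqr_ge0.
pose f (p : measurableTypeR R * measurableTypeR R) : \bar R :=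
  (h p.1 * (\1_[set q : R * R | 0 <= q.1 <= q.2] p * e p.2)%:E)%E.
have mf : measurable_fun setT f.
  apply: emeasurable_funM.
    apply: measurableT_comp => //.
  apply/measurable_EFinP; apply: measurable_funM.
    apply: measurable_indic.
    rewrite (_ : [set q : R * R | _] =
      [set q | 0 <= q.1] `&` [set q | q.1 <= q.2]); last first.
      by apply/seteqP; split => q /= /andP.
    apply: measurableI.
      rewrite -[X in measurable X]setTI.
      have := @measurable_fun_ler _ _ R setT (cst 0)
        (fst : measurableTypeR R * measurableTypeR R -> R).
      by move=> H; apply: (H _ _ measurableT [set true]).
    rewrite -[X in measurable X]setTI.
    have := @measurable_fun_ler _ _ R setT
      (fst : measurableTypeR R * measurableTypeR R -> R)
      (snd : measurableTypeR R * measurableTypeR R -> R).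
    by move=> H; apply: (H _ _ measurableT [set true]).
  by have /measurable_EFinP := measurableT_comp me
    (@measurable_snd _ _ (measurableTypeR R) (measurableTypeR R)).
have fE t r : f (t, r) = (h t * ((0 <= t <= r)%R%:R * e r)%:E)%E.
  rewrite /f/= indicE; congr (_ * ((nat_of_bool _)%:R * _)%:E)%E.
  by apply/idP/idP; rewrite inE.
have f0 p : (0 <= f p)%E.
  by rewrite mule_ge0// lee_fin mulr_ge0// indicE.
transitivity (\int[mu]_t \int[lebesgue_measure]_r f (t, r))%E.
  rewrite integral_mkcond; apply: eq_integral => t _.
  rewrite patchE mem_setE/= in_itv/= andbT; case: ifPn => t0.
    rewrite -integral_expR_tail// muleC -ge0_integralZl//; last 2 first.
    - exact: measurable_funS me.
    - by move=> r _; rewrite lee_fin e0.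
    rewrite [LHS]integral_mkcond; apply: eq_integral => r _.
    rewrite patchE fE mem_setE/= in_itv/= andbT t0/=.
    by case: ifPn => _; rewrite ?mul1r ?mul0r ?mule0.
  rewrite integral0_eq// => r _.
  by rewrite fE (negbTE t0)/= mul0r mule0.
rewrite fubini_tonelli//.
apply: eq_integral => r _.
rewrite -ge0_integralZl//; last 2 first.
- exact: measurable_funS mh.
- by rewrite lee_fin e0.
rewrite [RHS]integral_mkcond; apply: eq_integral => t _.
rewrite patchE fE mem_setE/= in_itv/=.
by case: ifPn => _; rewrite ?mul1r ?mul0r ?mule0// muleC.
Qed.

End discounting.

(** * Greedy division of a time budget *)

Section greedy_division.
Context {R : realType}.
Implicit Types h : R -> \bar R.

Let V h (x : R) := (\int[lebesgue_measure]_(s in `]0%R, x]) h s)%E.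

Lemma integral_itvoc_cst (x y : R) (c : \bar R) : x <= y ->
  (\int[lebesgue_measure]_(s in `]x, y]) (cst c s) = c * (y - x)%:E)%E.
Proof.
move=> xy; rewrite integral_cst //=.
by congr (_ * _)%E; rewrite /lebesgue_measure stieltjes_itvoc.
Qed.

Lemma integral_itvoc_split h (x y : R) : measurable_fun setT h ->
  (forall s, 0 <= h s)%E -> 0 <= x <= y ->
  (V h y = V h x + \int[lebesgue_measure]_(s in `]x, y]) h s)%E.
Proof.
move=> mhT h0 /andP[x0 xy].
have E : `]0%R, y]%classic = `]0%R, x]%classic `|` `]x, y]%classic.
  apply/seteqP; split => s /=; rewrite !in_itv/=.
    move=> /andP[s0 sy]; rewrite s0 sy/= andbT.
    by have [?|?] := leP s x; [left|right].
  by move=> [/andP[-> sx]|/andP[xs ->]]/=; lra.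
rewrite /V E ge0_integral_setU//.
- exact: measurable_funS mhT.
- apply/disj_setPS => s /= []; rewrite !in_itv/=; lra.
Qed.

(** As [h] crosses [c] at [y], moving a budget away from [y] earns at most [c]
    per unit of time added and loses at least [c] per unit removed. The terms
    in [c] are added on both sides instead of subtracted on one, which keeps the
    inequality meaningful for infinite rates. *)
Lemma integral_exchange_le h (x y : R) (c : \bar R) :
  {homo h : s t / s <= t >-> (t <= s)%E} -> (forall s, 0 <= h s)%E ->
  0 <= x -> 0 <= y -> (0 <= c)%E ->
  (forall s, 0 < s < y -> (c <= h s)%E) -> (h y <= c)%E ->
  (V h x + c * y%:E <= V h y + c * x%:E)%E.
Proof.
move=> nih h0 x0 y0 c0 hy yh.
have mhT : measurable_fun setT h by exact: nonincreasing_emeasurable.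
have split_c (u v : R) : 0 <= u <= v -> (c * v%:E = c * u%:E + c * (v - u)%:E)%E.
  move=> /andP[u0 uv]; rewrite -ge0_muleDr ?lee_fin//; last by lra.
  by rewrite -EFinD addrC subrK.
have V0 u : (0 <= V h u)%E by apply: integral_ge0.
have [xy|/ltW yx] := leP x y.
  rewrite (@integral_itvoc_split h x y) ?x0// (split_c x y) ?x0//.
  rewrite addeA [leRHS]addeAC; apply: leeD2l.
  rewrite -integral_itvoc_cst//.
  (* The bound below by c may fail at the end point y itself. *)
  rewrite -!integral_itv_bndo_bndc//; last exact: nonincreasing_emeasurable.
  apply: ge0_le_integral => //.
  - exact: nonincreasing_emeasurable.
  - by move=> s /=; rewrite in_itv/= => /andP[xs sy]; apply: hy; lra.
rewrite (@integral_itvoc_split h y x) ?y0// (split_c y x) ?y0//.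
rewrite addeAC [leRHS]addeA; apply: leeD2l.
rewrite -integral_itvoc_cst//.
apply: ge0_le_integral => //.
- exact: nonincreasing_emeasurable.
- move=> s /=; rewrite in_itv/= => /andP[ys sx].
  by apply: le_trans yh; apply: nih; exact: ltW.
Qed.

(** All the exchange inequalities share the same price [c], the largest marginal
    rate at [y]; summed over [k], the terms in [c] cancel because the budgets
    agree. *)
Lemma greedy_sum_le n (h : 'I_n -> R -> \bar R) (x y : 'I_n -> R) :
  (forall k, {homo h k : s t / s <= t >-> (t <= s)%E}) ->
  (forall k s, 0 <= h k s)%E ->
  (forall k, 0 <= x k) -> (forall k, 0 <= y k) ->
  \sum_k x k = \sum_k y k ->
  (forall k j s, 0 < s < y k -> (h j (y j) <= h k s)%E) ->
  (\sum_k V (h k) (x k) <= \sum_k V (h k) (y k))%E.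
Proof.
move=> nih h0 x0 y0 xy greedy.
pose c := \big[maxe/-oo%E]_(j < n) h j (y j).
have hc k : (h k (y k) <= c)%E by exact: le_bigmax.
have ch k s : 0 < s < y k -> (c <= h k s)%E.
  by move=> sy; apply: bigmax_le => [|j _]; [exact: leNye|exact: greedy].
have c0 (k : 'I_n) : (0 <= c)%E by apply: le_trans (hc k).
have ex k z : 0 <= z -> (V (h k) z + c * (y k)%:E <= V (h k) (y k) + c * z%:E)%E.
  by move=> z0; apply: integral_exchange_le => //; [exact: (c0 k)|exact: ch].
have V0 k u : (0 <= V (h k) u)%E by apply: integral_ge0.
have [n0|[k0 _]] : (forall k : 'I_n, False) \/ exists k : 'I_n, True.
  have [[k _]|N] := pselect (exists k : 'I_n, True); first by right; exists k.
  by left=> k; apply: N; exists k.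
  by rewrite !big1// => k; case: (n0 k).
have {}c0 := c0 k0.
have sumc (z : 'I_n -> R) : (forall k, 0 <= z k) ->
    (\sum_k c * (z k)%:E = c * (\sum_k z k)%:E)%E.
  by move=> z0; rewrite -sumEFin ge0_sume_distrr// => k _; rewrite lee_fin.
have [cfin|cnfin] := boolP ((c * (\sum_k y k)%:E)%E \is a fin_num).
  rewrite -(leeD2rE _ _ cfin) -{1}sumc// -xy -sumc// -!big_split/=.
  by apply: lee_sum => k _; exact: ex.
(* The price is infinite and some time is allotted: the right-hand side is
   infinite too. *)
have [k yk0] : exists k, 0 < y k.
  apply: contrapT => /forallNP Ny; move: cnfin; rewrite big1 ?mule0//.
  by move=> k _; apply/eqP; rewrite eq_le y0 andbT leNgt; apply/negP.
have coo : c = +oo%E.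
  move: c0 cnfin; case: (c) => //= r _; by rewrite -EFinM.
have := ex k 0 (lexx _); rewrite mule0 adde0 coo gt0_mulye ?lte_fin//.
rewrite {1}/V set_itvoc0 integral_set0 add0e leye_eq => /eqP Vy.
rewrite [leRHS](bigD1 k)//= Vy addye ?leey// gt_eqF//.
by apply: lt_le_trans (sume_ge0 _ _).
Qed.

End greedy_division.

(** * Optimality of greedy time changes *)

Section allocation.
Context {R : realType}.

(** Both values are mixtures over [r], with the same weights, of the rewards
    collected up to [r], and at each [r] the division by [G] is greedy. *)
Lemma allocation_value_le n (beta : R) (h : 'I_n -> R -> \bar R)
    (F G : 'I_n -> cumulative R R) :
  0 < beta ->
  (forall k, {homo h k : s t / s <= t >-> (t <= s)%E}) ->
  (forall k s, 0 <= h k s)%E ->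
  (forall k, continuous (F k)) -> (forall k, continuous (G k)) ->
  (forall k t, t <= 0 -> F k t = 0) -> (forall k t, t <= 0 -> G k t = 0) ->
  (forall t, \sum_k F k t = \sum_k G k t) ->
  (forall k j s t, 0 < s < G k t -> (h j (G j t) <= h k s)%E) ->
  (\sum_k \int[lebesgue_stieltjes_measure (F k)]_(t in `[0%R, +oo[)
     ((beta * expR (- (beta * t)))%:E * h k (F k t)) <=
   \sum_k \int[lebesgue_stieltjes_measure (G k)]_(t in `[0%R, +oo[)
     ((beta * expR (- (beta * t)))%:E * h k (G k t)))%E.
Proof.
move=> b0 nih h0 cF cG F0 G0 FG greedy.
pose V k x := (\int[lebesgue_measure]_(s in `]0%R, x]) h k s)%E.
pose e (r : R) := beta ^+ 2 * expR (- (beta * r)).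
have e0 r : 0 <= e r by rewrite mulr_ge0 ?expR_ge0// sqr_ge0.
have V0 k x : (0 <= V k x)%E by apply: integral_ge0.
have mh k : measurable_fun setT (h k) by exact: nonincreasing_emeasurable.
have me : measurable_fun setT (EFin \o e).
  apply/measurable_EFinP; apply: measurable_funM => //.
  apply: measurableT_comp => //; apply: measurable_funN.
  exact: measurable_funM.
have ge0 (H : 'I_n -> cumulative R R) k t :
    (forall k t, t <= 0 -> H k t = 0) -> 0 <= H k t.
  move=> H0; have [t0|/ltW t0] := leP t 0; first by rewrite H0.
  by rewrite -(H0 k _ (lexx 0)); exact: cumulative_is_nondecreasing.
have valueE (H : 'I_n -> cumulative R R) : (forall k, continuous (H k)) ->
    (forall k t, t <= 0 -> H k t = 0) ->
    (\sum_k \int[lebesgue_stieltjes_measure (H k)]_(t in `[0%R, +oo[)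
     ((beta * expR (- (beta * t)))%:E * h k (H k t)) =
    \int[lebesgue_measure]_r ((e r)%:E * \sum_k V k (H k r)))%E
    /\ measurable_fun setT (fun r => (e r)%:E * \sum_k V k (H k r))%E.
  move=> cH H0.
  have mVH k : measurable_fun setT (fun r => V k (H k r)).
    apply: nondecreasing_emeasurable => // s t st.
    apply: ge0_subset_integral => //; first exact: measurable_funS (mh k).
    by apply: subset_itvl; rewrite bnd_simp; exact: cumulative_is_nondecreasing.
  have meV k : measurable_fun setT (fun r => (e r)%:E * V k (H k r))%E.
    exact: (emeasurable_funM me (mVH k)).
  split; last by apply: emeasurable_funM => //; exact: emeasurable_sum.
  transitivity (\sum_k \int[lebesgue_measure]_r ((e r)%:E * V k (H k r)))%E.
    apply: eq_bigr => k _.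
    have mhH : measurable_fun setT (fun t => h k (H k t)).
      apply: measurableT_comp; first exact: mh.
      exact: continuous_measurable_fun.
    have -> := @discounted_integral _ (lebesgue_stieltjes_measure (H k)) _ _ b0
      mhH (fun t => h0 k (H k t)).
    apply: eq_integral => r _; apply: (congr1 (mule _)).
    have [r0|r0] := leP 0 r.
      exact: (integral_stieltjes_comp0 r0 (cH k) (H0 k) (mh k) (h0 k)).
    have -> : V k (H k r) = 0%E.
      by rewrite (H0 k r (ltW r0)) /V set_itvoc0 integral_set0.
    rewrite (_ : `[0%R, r]%classic = set0) ?integral_set0//.
    by apply/seteqP; split => t //=; rewrite in_itv/=; lra.
  rewrite -ge0_integral_sum//; last first.
    by move=> k r _; apply: mule_ge0; [by rewrite lee_fin e0|exact: V0].
  by apply: eq_integral => r _; rewrite ge0_sume_distrr.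
have [vF mF] := valueE F cF F0; have [vG mG] := valueE G cG G0.
rewrite [leLHS]vF [leRHS]vG.
apply: ge0_le_integral => //.
- by move=> r _; apply: mule_ge0; [by rewrite lee_fin e0|exact: sume_ge0].
- move=> r _; apply: lee_wpmul2l; first by rewrite lee_fin.
  by apply: greedy_sum_le => // *; [exact: ge0|exact: ge0|exact: greedy].
Qed.

End allocation.

(** * Paths of policies and index policies *)

Section pathwise.
Context {R : realType} {dO : measure_display} {Omega : measurableType dO}.
Context {n : nat} {a : 'I_n -> arm R Omega}.
Implicit Types (T : policy a) (k : 'I_n) (w : Omega).

Lemma clock_path_le0 T k w (t : R) : t <= 0 -> clock_path T k w t = 0.
Proof. by move=> t0; rewrite /clock_path (max_idPl t0) clock0. Qed.

Lemma clock_path_ge0 T k w (t : R) : 0 <= t -> clock_path T k w t = T k t w.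
Proof. by move=> t0; rewrite /clock_path (max_idPr t0). Qed.

Lemma sum_clock_path T w (t : R) :
  \sum_k clock_path T k w t = Num.max 0 t.
Proof. by rewrite /clock_path clock_sum// le_max lexx. Qed.

Lemma clock_path_dist T k w (s t : R) :
  `|clock_path T k w s - clock_path T k w t| <= `|s - t|.
Proof.
wlog st : s t / s <= t.
  move=> H; have [|/ltW] := leP s t; first exact: H.
  by move=> /H; rewrite distrC (distrC t).
rewrite distrC (distrC s) !ger0_norm ?subr_ge0//; last exact: clock_path_nd.
have m0 x : 0 <= Num.max 0 x :> R by rewrite le_max lexx.
apply: le_trans (clock_lip T k w (m0 s) _) _.
  by rewrite ge_max !le_max lexx st orbT.
by rewrite !maxEle; case: ifPn => ?; case: ifPn => ?; lra.
Qed.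

Lemma clock_path_continuous T k w : continuous (clock_path T k w).
Proof.
move=> x; apply/cvgrPdist_le => e e0; near=> t.
apply: le_trans (clock_path_dist T k w x t) _.
near: t; apply: cvgr_dist_le e e0; exact: cvg_id.
Unshelve. all: by end_near. Qed.

Lemma lower_envelope_nonincreasing (M : R -> Omega -> \bar R) w :
  {homo (fun t => lower_envelope M t w) : s t / s <= t >-> (t <= s)%E}.
Proof.
move=> s t st; apply: le_ereal_inf => _ [u us <-]; exists u => //.
by move: us => /=; rewrite !in_itv/= => /andP[->]/= /le_trans; apply.
Qed.

Lemma lower_envelope_ge0 (M : R -> Omega -> \bar R) w (t : R) :
  (forall u, 0 <= u -> (0 <= M u w)%E) -> (0 <= lower_envelope M t w)%E.
Proof.
move=> M0; apply: le_ereal_inf_tmp => _ [u us <-]; apply: M0.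
by move: us => /=; rewrite in_itv/= => /andP[].
Qed.

Lemma lower_envelope_le (M : R -> Omega -> \bar R) w (u t : R) :
  0 <= u <= t -> (lower_envelope M t w <= M u w)%E.
Proof. by move=> ut; apply: ereal_inf_lbound; exists u => //=; rewrite in_itv. Qed.

(** An index policy leaves each level [u] below [clock_path T k w t] at a time
    when arm [k] has the largest index, and this index dominates the present
    envelope of every other arm. *)
Lemma index_policy_greedy (M : 'I_n -> R -> Omega -> \bar R) T w :
  (forall k t, 0 <= t -> (forall h, 0 < h -> T k t w < T k (t + h) w) ->
     M k (T k t w) w = \big[maxe/-oo%E]_(j < n) M j (T j t w) w) ->
  forall k j s t, s < clock_path T k w t ->
    (lower_envelope (M j) (clock_path T j w t) w <= lower_envelope (M k) s w)%E.
Proof.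
move=> idx k j s t st; apply: le_ereal_inf_tmp => _ [u us <-].
have /andP[u0 {}us] : 0 <= u <= s by move: us; rewrite /= in_itv.
have F0 : clock_path T k w 0 <= u by rewrite clock_path_le0.
(* x is the last time at which the k-th clock shows u; the clock right
   increases there, which a first passage would not guarantee. *)
have [x /andP[x0 xt] [Fx xF]] := last_passage (clock_path_nd T k w)
  (@clock_path_continuous T k w) F0 (le_lt_trans us st).
have Tx : T k x w = u by rewrite -clock_path_ge0.
have -> : M k u w = \big[maxe/-oo%E]_(j < n) M j (T j x w) w.
  rewrite -[in LHS]Tx; apply: idx => // h h0.
  by rewrite Tx -clock_path_ge0 ?xF ?ltrDl// addr_ge0// ltW.
apply: le_trans (le_bigmax _ _ j); apply: lower_envelope_le.
rewrite -clock_path_ge0// -{1}(clock_path_le0 T j w (lexx 0)).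
by rewrite !clock_path_nd// ltW.
Qed.

End pathwise.

(** * Almost everywhere comparison without measurability *)

Section ae_comparison.
Local Open Scope ereal_scope.
Import HBNNSimple.

(** A simple function below [f] can be set to 0 on the exceptional null set
    without changing its integral, and is then below [g]. *)
Lemma ae_le_integral_nonmeasurable d (T : measurableType d) (R : realType)
    (mu : {measure set T -> \bar R}) (f g : T -> \bar R) :
  (forall x, 0 <= f x) -> (forall x, 0 <= g x) ->
  {ae mu, forall x, f x <= g x} -> \int[mu]_x f x <= \int[mu]_x g x.
Proof.
move=> f0 g0 [N [mN N0 fgN]].
rewrite [leLHS]ge0_integralTE// [leRHS]ge0_integralTE//.
apply: ge_ereal_sup => _ [h hf <-].
have mNC := measurableC mN.
apply: le_ereal_sup_tmp; exists (sintegral mu (proj_nnsfun h mNC)).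
  exists (proj_nnsfun h mNC) => // x; rewrite /= mindicE.
  have [xN|xN] := boolP (x \in ~` N); last by rewrite mulr0.
  rewrite mulr1; apply: le_trans (hf x) _.
  apply: contrapT => fgx; move: xN; rewrite inE; apply.
  exact: fgN.
rewrite -!integralT_nnsfun.
rewrite (@ge0_negligible_integral _ _ _ mu setT N (fun x => (h x)%:E))//;
  last 2 first.
  exact/measurable_EFinP.
  by move=> x _; rewrite lee_fin.
rewrite setTD integral_mkcond.
rewrite le_eqVlt; apply/orP; left; apply/eqP.
apply: eq_integral => x _; rewrite patchE/= mindicE.
by case: ifPn => _; rewrite ?mulr1 ?mulr0.
Qed.

End ae_comparison.

(** * Comparison of the lower values *)

Theorem lemma4p1 (R : realType) (dO : measure_display)
    (Omega : measurableType dO) (P : probability Omega R)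
    (beta : R) (n : nat) (a : 'I_n -> arm R Omega)
    (M : 'I_n -> R -> Omega -> \bar R)
    (hbeta : 0 < beta) (hn : (1 <= n)%N)
    (ha : rmab P beta a)
    (hM : forall k, gittins_index_process P beta (a k) (M k))
    (T That : policy a) (hThat : index_policy P M That) :
  (lower_value P beta M T <= lower_value P beta M That)%E.
Proof.
have m0 k t w : (0 <= lower_envelope (M k) t w)%E.
  by apply: lower_envelope_ge0 => u u0; exact: (gittins_ge0 (hM k)).
have val0 (S : policy a) w : (0 <= \sum_(k < n)
    \int[lebesgue_stieltjes_measure (clock_path S k w)]_(t in `[0%R, +oo[)
      ((beta * expR (- (beta * t)))%:E * lower_envelope (M k) (S k t w) w))%E.
  apply: sume_ge0 => k _; apply: integral_ge0 => t _.
  by apply: mule_ge0 => //; rewrite lee_fin mulr_ge0 ?expR_ge0// ltW.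
rewrite /lower_value; apply: ae_le_integral_nonmeasurable => //.
apply: filterS hThat => w [idx _].
have pathE (S : policy a) : (\sum_(k < n)
    \int[lebesgue_stieltjes_measure (clock_path S k w)]_(t in `[0%R, +oo[)
      ((beta * expR (- (beta * t)))%:E * lower_envelope (M k) (S k t w) w) =
  \sum_(k < n)
    \int[lebesgue_stieltjes_measure (clock_path S k w)]_(t in `[0%R, +oo[)
      ((beta * expR (- (beta * t)))%:E *
        lower_envelope (M k) (clock_path S k w t) w))%E.
  apply: eq_bigr => k _; apply: eq_integral => t.
  by rewrite mem_setE/= in_itv/= andbT => t0; rewrite clock_path_ge0.
rewrite [leLHS]pathE [leRHS]pathE.
pose path (S : policy a) k : cumulative R R := clock_path S k w.
apply: (@allocation_value_le R n beta (fun k s => lower_envelope (M k) s w)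
  (path T) (path That)) => //.
- by move=> k; exact: lower_envelope_nonincreasing.
- by move=> k; exact: clock_path_continuous.
- by move=> k; exact: clock_path_continuous.
- by move=> k t; exact: clock_path_le0.
- by move=> k t; exact: clock_path_le0.
- by move=> t; rewrite !sum_clock_path.
- by move=> k j s t /andP[_ st]; exact: index_policy_greedy.
Qed.
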